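(* Let $K$ be a field of characteristic zero and let $f\in K[[x]]$ be a compositionally invertible formal power series with $f\neq\mathrm{id}$, with Taylor coefficients $f_n=D^n(f)(0)$. Then $f$ is involutory (i.e. $f\circ f=\mathrm{id}$) if and only if there exist constants $g_1\,(\neq0),g_2,g_3,\ldots\in K$ such that $f_n=L_{n,1}(g_1,g_2,\ldots,g_{2[n/2]})$ for all $n\ge1$.
   Context: A formal power series $f\in K[[x]]$ is compositionally invertible iff $f(0)=0$ and $f'(0)\neq0$; $\mathrm{id}(x)=x$. $D^n(f)(0)$ is the $n$-th Taylor coefficient $n!\,[x^n]f$. $B_{n,k}\in K[X_1,\ldots,X_{n-k+1}]$ is the partial Bell polynomial $B_{n,k}=\sum \frac{n!}{k_1!k_2!\cdots}\prod_j (X_j/j!)^{k_j}$ over nonnegative $k_1,k_2,\ldots$ with $\sum k_j=k$, $\sum jk_j=n$. $A_{n,k}\in K[X_1^{-1},X_2,\ldots,X_{n-k+1}]$ ($1\le k\le n$) are the unique Laurent polynomials with $\sum_{j=k}^n A_{n,j}B_{j,k}=\delta_{nk}$ for $1\le k\le n$ (equivalently, $A_{n,k}(g_1,\ldots,g_{n-k+1})$ is the $n$-th Taylor coefficient of $(g^{-1})^k/k!$ for every invertible $g$ with Taylor coefficients $g_r$, $g^{-1}$ the compositional inverse). The multivariable Lah polynomials are $L_{n,k}=\sum_{j=k}^n(-1)^jA_{n,j}B_{j,k}$. The polynomial $L_{n,1}$ involves only $X_1,\ldots,X_{2[n/2]}$ ($[\cdot]$ the integer part), and $L_{n,1}(g_1,\ldots,g_{2[n/2]})$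 denotes substitution $X_j=g_j$. *)

(* Defs.v *)
From HB Require Import structures.
From mathcomp Require Import all_boot all_algebra finmap ring zify.
From mathcomp.multinomials Require Import monalg.

Set Implicit Arguments.
Unset Strict Implicit.
Unset Printing Implicit Defensive.

Import GRing.Theory.
Local Open Scope ring_scope.

Section PowerSeries.
Variable K : fieldType.

(* The power series \sum_n f n * x^n; two series are equal when they are =1. *)
Definition fps := nat -> K.

Implicit Types f g : fps.

Definition fps_one : fps := fun n => (n == 0%N)%:R.
Definition fps_id : fps := fun n => (n == 1%N)%:R.
Definition fps_mul f g : fps := fun n => \sum_(i < n.+1) f i * g (n - i)%N.
Definition fps_pow f k : fps := iter k (fps_mul f) fps_one.

(* f o g, only meaningful when g 0 = 0: then x^k divides g^k, so that the
   powers of exponent k > n do not contribute to the coefficient of x^n. *)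
Definition fps_comp f g : fps :=
  fun n => \sum_(k < n.+1) f k * fps_pow g k n.

(* D^n(f)(0) *)
Definition taylor f n : K := n`!%:R * f n.

Definition fps_invertible f := f 0%N = 0 /\ taylor f 1 != 0.

Definition involutory f := fps_comp f f =1 fps_id.

End PowerSeries.

Definition monomial := {cmonom nat}.

HB.instance Definition _ := ConomialDef.on monomial.

Section MonomialEvaluation.
Variable S : comNzRingType.

Definition cmonom_eval (v : nat -> S) (m : monomial) : S :=
  \prod_(i <- finsupp m) v i ^+ m i.

Lemma cmonom_evalEw v (m : monomial) (d : {fset nat}) :
  (finsupp m `<=` d)%fset -> cmonom_eval v m = \prod_(i <- d) v i ^+ m i.
Proof.
move=> le; rewrite /cmonom_eval (big_fset_incl _ le) //.
by move=> i _; rewrite -cmE_neq0 negbK => /eqP ->.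
Qed.

Lemma cmonom_eval_morphism v : mmorphism (cmonom_eval v).
Proof.
split=> [m1 m2|]; last by rewrite /cmonom_eval mdom1 big_seq_fset0.
rewrite (@cmonom_evalEw v m1 _ (fsubsetUl _ (finsupp m2))).
rewrite (@cmonom_evalEw v m2 _ (fsubsetUr (finsupp m1) _)).
rewrite /cmonom_eval mdomD -big_split /=.
by apply: eq_bigr => i _; rewrite cmM exprD.
Qed.

HB.instance Definition _ v :=
  isMultiplicative.Build monomial S (cmonom_eval v) (cmonom_eval_morphism v).

End MonomialEvaluation.

Lemma eqmodM (R : comNzRingType) (p p' q q' r s u : R) :
  p - p' = r * u -> q - q' = s * u -> p * q - p' * q' = (r * q + p' * s) * u.
Proof.
move=> er es; have -> : p * q - p' * q' = (p - p') * q + p' * (q - q') by ring.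
by rewrite er es; ring.
Qed.

Lemma strong_recursion (T : Type) (x0 : T) (G : (nat -> T) -> nat -> T) :
    (forall s s' i, (forall j, (j < i)%N -> s j = s' j) -> G s i = G s' i) ->
  {s | forall i, s i = G s i}.
Proof.
move=> extG.
pose t := fix t i := if i is i'.+1
  then fun j => if j == i' then G (t i') i' else t i' j else fun=> x0.
have tE i j : (j < i)%N -> t i j = G (t j) j.
  elim: i => //= i IHi; rewrite ltnS leq_eqVlt.
  by case: eqVneq => [-> //|_ /=]; apply: IHi.
exists (fun i => G (t i) i) => i; apply: extG => j; exact: tE.
Qed.

Lemma triangular_recursion (R : comNzRingType) (y : nat -> R)
    (b : nat -> nat -> R) :
  {a : nat -> nat -> R | (forall n, a n n = y n) /\
    forall n k, (k < n)%N -> a n k = - \sum_(k.+1 <= j < n.+1) a n j * b j k}.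
Proof.
pose G := fun n (c : nat -> R) i => if i == 0%N then y n else
  - \sum_((n - i).+1 <= j < n.+1) c (n - j)%N * b j (n - i)%N.
have extG n (c c' : nat -> R) i :
    (forall j, (j < i)%N -> c j = c' j) -> G n c i = G n c' i.
  move=> cc'; rewrite /G; have [_|i0] := eqVneq i 0%N; first by [].
  by congr (- _); apply: eq_big_nat => j jn; rewrite cc' //; lia.
pose c n := sval (strong_recursion 0 (extG n)).
have cE n : forall i, c n i = G n (c n) i.
  by rewrite /c; case: (strong_recursion _ _).
exists (fun n k => c n (n - k)%N); split=> [n|n k kn]; rewrite cE /G.
  by rewrite subnn.
by rewrite subn_eq0 leqNgt kn /= subKn // ltnW.
Qed.

(* Polynomials over K in the variables var 0, var 1, var 2, ...  For j > 0,
   var j is X_j, while var 0 plays the role of X_1^-1: the Laurent polynomial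
   ring K[X_1, X_1^-1, X_2, X_3, ...] is the quotient of lpoly K by the ideal
   generated by var 0 * var 1 - 1, and laurent_eq is equality in it. *)
Notation lpoly K := {malg K[monomial]}.

HB.lock Definition var (K : fieldType) (i : nat) : lpoly K := << ucm i >>.
Arguments var {K} i.

Section LaurentPolynomials.
Variable K : fieldType.

Implicit Types (p q : lpoly K) (v w : nat -> K) (D : pred nat).
Implicit Types (m : monomial) (A : nat -> nat -> lpoly K).

Definition laurent_eq p q := exists r, p - q = r * (var 0 * var 1 - 1).

Definition only_vars D p :=
  forall m, m \in msupp p -> forall i, i \in finsupp m -> D i.

(* Substitution X_j := g j for j > 0; the value g 0 is irrelevant. *)
Definition laurent_point (g : nat -> K) (i : nat) : K :=
  if i == 0%N then (g 1%N)^-1 else g i.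

Definition laurent_eval (g : nat -> K) p : K :=
  mmap idfun (cmonom_eval (laurent_point g)) p.

(* m i is the multiplicity k_j of j = i.+1; the bounds j <= n and k_j <= n
   lose nothing, because \sum_j j k_j = n. *)
Definition bell (n k : nat) : lpoly K :=
  \sum_(m : {ffun 'I_n -> 'I_n.+1} |
          (\sum_(i < n) m i == k)%N && (\sum_(i < n) i.+1 * m i == n)%N)
    (n`!%:R / (\prod_(i < n) (m i)`!)%:R)
      *: \prod_(i < n) ((i.+1)`!%:R^-1 *: var i.+1) ^+ m i.

(* A n k lies in K[X_1^-1, X_2, ..., X_(n-k+1)], and the infinite lower
   triangular matrices (A n k) and (bell n k) are inverse to each other. *)
Definition bell_inverse A :=
  (forall n k, (0 < k <= n)%N ->
     only_vars (fun i => (i == 0)%N || (1 < i <= n - k + 1))%N (A n k)) /\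
  (forall n k, (0 < k <= n)%N ->
     laurent_eq (\sum_(k <= j < n.+1) A n j * bell j k) (n == k)%:R).

Lemma only_vars_sub D D' p :
  (forall i, D i -> D' i) -> only_vars D p -> only_vars D' p.
Proof. by move=> sDD' Dp m mp i im; apply/sDD'/(Dp m). Qed.

Lemma only_varsC D c : only_vars D c%:MP.
Proof.
move=> m /(fsubsetP (msuppC_le _)); rewrite in_fset1 => /eqP -> i.
by rewrite mdom1 in_fset0.
Qed.

Lemma only_vars0 D : only_vars D 0.
Proof. by move=> m; rewrite msupp0 in_fset0. Qed.

Lemma only_vars1 D : only_vars D 1.
Proof. exact: only_varsC. Qed.

Lemma only_varsN D p : only_vars D p -> only_vars D (- p).
Proof. by move=> Dp m; rewrite msuppN; apply: Dp. Qed.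

Lemma only_varsD D p q : only_vars D p -> only_vars D q -> only_vars D (p + q).
Proof.
move=> Dp Dq m /(fsubsetP (msuppD_le _ _)); rewrite in_fsetU.
by case/orP; [apply: Dp | apply: Dq].
Qed.

Lemma only_varsM D p q : only_vars D p -> only_vars D q -> only_vars D (p * q).
Proof.
move=> Dp Dq m /msuppM_le [m1 [m2 [m1p m2q ->]]] i.
by rewrite mdomD in_fsetU => /orP[]; [apply: Dp | apply: Dq].
Qed.

Lemma only_varsZ D c p : only_vars D p -> only_vars D (c *: p).
Proof. by move=> Dp m /(fsubsetP (msuppZ_le _ _)); apply: Dp. Qed.

Lemma only_varsX D p n : only_vars D p -> only_vars D (p ^+ n).
Proof.
move=> Dp; elim: n => [|n IHn]; first by rewrite expr0; apply: only_vars1.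
by rewrite exprS; apply: only_varsM.
Qed.

Lemma only_vars_var (D : pred nat) i : D i -> only_vars D (var i).
Proof.
move=> Di m; rewrite var.unlock msuppU1 in_fset1 => /eqP -> j.
by rewrite mdomU in_fset1 => /eqP ->.
Qed.

Lemma only_vars_sum D (I : Type) (r : seq I) (P : pred I) (F : I -> lpoly K) :
  (forall i, P i -> only_vars D (F i)) -> only_vars D (\sum_(i <- r | P i) F i).
Proof. exact: (big_ind _ (@only_vars0 D) (@only_varsD D)). Qed.

Lemma only_vars_prod D (I : Type) (r : seq I) (P : pred I) (F : I -> lpoly K) :
  (forall i, P i -> only_vars D (F i)) -> only_vars D (\prod_(i <- r | P i) F i).
Proof. exact: (big_ind _ (@only_vars1 D) (@only_varsM D)). Qed.

Lemma laurent_eqW p q : p = q -> laurent_eq p q.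
Proof. by move->; exists 0; rewrite subrr mul0r. Qed.

Lemma laurent_eqxx p : laurent_eq p p.
Proof. exact: laurent_eqW. Qed.

Lemma laurent_eqD p p' q q' :
  laurent_eq p p' -> laurent_eq q q' -> laurent_eq (p + q) (p' + q').
Proof.
by move=> [r er] [s es]; exists (r + s); rewrite mulrDl -er -es addrACA -opprD.
Qed.

Lemma laurent_eqN p q : laurent_eq p q -> laurent_eq (- p) (- q).
Proof. by move=> [r er]; exists (- r); rewrite mulNr -er opprD. Qed.

Lemma laurent_eqB p p' q q' :
  laurent_eq p p' -> laurent_eq q q' -> laurent_eq (p - q) (p' - q').
Proof. by move=> ep /laurent_eqN; apply: laurent_eqD. Qed.

Lemma laurent_eqM p p' q q' :
  laurent_eq p p' -> laurent_eq q q' -> laurent_eq (p * q) (p' * q').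
Proof.
by move=> [r er] [s es]; exists (r * q + p' * s); exact: eqmodM er es.
Qed.

Lemma laurent_eqX p q n : laurent_eq p q -> laurent_eq (p ^+ n) (q ^+ n).
Proof.
move=> pq; elim: n => [|n IHn]; first by rewrite !expr0; apply: laurent_eqxx.
by rewrite !exprS; apply: laurent_eqM.
Qed.

Lemma laurent_eqZ c p q : laurent_eq p q -> laurent_eq (c *: p) (c *: q).
Proof. by move=> [r er]; exists (c *: r); rewrite -scalerAl -er scalerBr. Qed.

Lemma laurent_eq_sum (I : Type) (r : seq I) (P : pred I) (F G : I -> lpoly K) :
    (forall i, P i -> laurent_eq (F i) (G i)) ->
  laurent_eq (\sum_(i <- r | P i) F i) (\sum_(i <- r | P i) G i).
Proof.
apply: (big_ind2 laurent_eq); first exact: laurent_eqxx.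
by move=> *; apply: laurent_eqD.
Qed.

Lemma laurent_eqXX n : laurent_eq (var 0 ^+ n * var 1 ^+ n) 1.
Proof.
rewrite -exprMn -[X in laurent_eq _ X](expr1n _ n).
by apply: laurent_eqX; exists 1; apply: esym (mul1r _).
Qed.

Lemma laurent_eq_trans q p r :
  laurent_eq p q -> laurent_eq q r -> laurent_eq p r.
Proof.
by move=> [s es] [t et]; exists (s + t); rewrite mulrDl -es -et addrA subrK.
Qed.

Lemma mcoeffMU p m m' : (p * << m >>)@_(mmul m' m) = p@_m'.
Proof.
have inj k : (mmul k m == mmul m' m) = (k == m').
  apply/eqP/eqP => [/eqP/cmP e|-> //]; apply/eqP/cmP => i.
  by move: (e i); rewrite !cmM => /addIn.
rewrite [p * _]fgmulgU raddf_sum /= [in RHS](monalgE p) raddf_sum /=.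
by apply: eq_bigr => k _; rewrite !mcoeffU mulr1 inj.
Qed.

(* K[X_1^-1, X_2, X_3, ...] embeds in the Laurent polynomial ring *)
Lemma laurent_eq0_free p :
  only_vars (fun i => i != 1%N) p -> laurent_eq p 0 -> p = 0.
Proof.
move=> p1 [r]; rewrite subr0 mulrBr [X in _ - X]mulr1.
pose u : monomial := mmul (ucm 0 : monomial) (ucm 1).
have -> : var 0 * var 1 = << u >> :> lpoly K.
  by rewrite !var.unlock [LHS]fgmulUU mulr1.
move=> ep; suff r0 : r = 0 by rewrite ep r0 mul0r subr0.
have p0 m : p@_(mmul m u) = 0.
  apply: mcoeff_outdom; apply/negP => /p1 /(_ 1) p1m.
  by suff /p1m : 1%N \in finsupp (mmul m u) by []; rewrite mdomD mdomD !mdomU !inE orbT.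
have rS m : r@_m = r@_(mmul m u).
  have := p0 m; rewrite ep mcoeffB mcoeffMU => /eqP.
  by rewrite subr_eq0 => /eqP.
have rI m t : exists2 m', r@_m = r@_m' & (t <= mdeg m')%N.
  elim: t => [|t [m' -> le]]; first by exists m.
  exists (mmul m' u); first exact: rS.
  by rewrite !mdegM !mdegU addn1 addnS ltnS (leq_trans le) ?leq_addr.
apply/malgP => m; rewrite mcoeff0.
have [m' -> le] := rI m (msize r).
by apply: mcoeff_outdom; apply: msize_mdeg_ge.
Qed.

Lemma laurent_evalB g : {morph laurent_eval g : p q / p - q}.
Proof. exact: rmorphB. Qed.

Lemma laurent_evalD g : {morph laurent_eval g : p q / p + q}.
Proof. exact: rmorphD. Qed.

Lemma laurent_evalM g : {morph laurent_eval g : p q / p * q}.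
Proof. exact: rmorphM. Qed.

Lemma laurent_eval_nat g n : laurent_eval g n%:R = n%:R.
Proof. exact: rmorph_nat. Qed.

Lemma laurent_eval_sum g (I : Type) (r : seq I) (P : pred I) F :
  laurent_eval g (\sum_(i <- r | P i) F i)
  = \sum_(i <- r | P i) laurent_eval g (F i).
Proof. exact: rmorph_sum. Qed.

Lemma laurent_eval_sign g n : laurent_eval g ((-1) ^+ n) = (-1) ^+ n.
Proof. exact: rmorph_sign. Qed.

Lemma laurent_eval_var g i : laurent_eval g (var i) = laurent_point g i.
Proof.
by rewrite var.unlock /laurent_eval mmapU mul1r /= /cmonom_eval mdomU big_seq_fset1 cmUU.
Qed.

Lemma laurent_eval_eq g p q :
  g 1%N != 0 -> laurent_eq p q -> laurent_eval g p = laurent_eval g q.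
Proof.
move=> g1 [r er]; apply/eqP; rewrite -subr_eq0 -laurent_evalB er.
rewrite laurent_evalM laurent_evalB laurent_evalM !laurent_eval_var.
by rewrite (laurent_eval_nat g 1) /laurent_point /= mulVf // subrr mulr0.
Qed.

Lemma eq_laurent_eval D g h p : only_vars D p ->
    (forall i, D i -> laurent_point g i = laurent_point h i) ->
  laurent_eval g p = laurent_eval h p.
Proof.
move=> Dp gh; rewrite /laurent_eval !mmapE; apply: eq_big_seq => m mp.
congr (_ * _); apply: eq_big_seq => i im.
by rewrite gh //; apply: Dp im.
Qed.

Lemma bell_bound n k (m : {ffun 'I_n -> 'I_n.+1}) (i : 'I_n) :
    (\sum_(i < n) m i == k)%N -> (\sum_(i < n) i.+1 * m i == n)%N ->
  m i != 0%N :> nat -> (i.+1 <= n - k + 1)%N.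
Proof.
move=> /eqP sk /eqP sn mi; suff le : (i * m i <= n - k)%N.
  by rewrite addn1 ltnS (leq_trans _ le) // leq_pmulr // lt0n.
have -> : (n - k = \sum_(i < n) i * m i)%N.
  rewrite -{1}sn -{}sk.
  rewrite (eq_bigr (fun i : 'I_n => m i + i * m i)%N) => [|j _]; last first.
    by rewrite mulSn.
  by rewrite big_split /= addKn.
by rewrite (bigD1 i) //= leq_addr.
Qed.

Lemma only_vars_bell n k :
  only_vars (fun i => 0 < i <= n - k + 1)%N (bell n k).
Proof.
apply: only_vars_sum => m /andP[sk sn]; apply/only_varsZ/only_vars_prod => i _.
have [->|mi] := eqVneq (m i : nat) 0%N; first by rewrite expr0; apply: only_vars1.
by apply/only_varsX/only_varsZ/only_vars_var/(bell_bound sk sn mi).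
Qed.

Lemma bell_diag n : [pchar K] =i pred0 -> (0 < n)%N -> bell n n = var 1 ^+ n.
Proof.
case: n => // n /pcharf0P K0 _.
pose m0 : {ffun 'I_n.+1 -> 'I_n.+2} := [ffun i => if i == ord0 then ord_max else ord0].
have m00 (i : 'I_n.+1) : i != ord0 -> m0 i = 0%N :> nat.
  by rewrite ffunE => /negbTE ->.
have m0n : m0 ord0 = n.+1 :> nat by rewrite ffunE.
rewrite /bell (big_pred1 m0) => [|m].
  have -> : (\prod_(i < n.+1) (m0 i)`! = n.+1`!)%N.
    by rewrite (bigD1 ord0) //= m0n big1 ?muln1 // => i /m00 ->.
  have -> : \prod_(i < n.+1) ((i.+1)`!%:R^-1 *: var i.+1) ^+ m0 i
            = var 1 ^+ n.+1 :> lpoly K.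
    rewrite (bigD1 ord0) //= m0n big1 ?mulr1 => [|i /m00 ->]; last exact: expr0.
    by rewrite -[1`!]/1%N invr1 scale1r.
  by rewrite divff ?scale1r // K0 -lt0n fact_gt0.
apply/andP/eqP => [[sk sn]|->]; last first.
  rewrite big_ord_recl [in X in _ /\ X]big_ord_recl m0n.
  by rewrite !big1 => [|i _|i _]; rewrite ?m00 ?muln0 ?addn0 ?mul1n.
have m_0 (i : 'I_n.+1) : i != ord0 -> m i = 0%N :> nat.
  move=> i0; apply/eqP/negPn/negP => mi; have := bell_bound sk sn mi.
  by rewrite subnn add0n ltnS leqn0; apply/negP.
apply/ffunP => i; apply/val_inj => /=.
have [->|i0] := eqVneq i ord0; last by rewrite m_0 ?m00.
rewrite m0n; move: sk; rewrite (bigD1 ord0) //= big1 => [|j /m_0 -> //].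
by rewrite addn0 => /eqP.
Qed.

(* The product of bell n k and X_1^-k is a polynomial in X_1^-1, X_2, ... *)
Definition bell_reduced (n k : nat) : lpoly K :=
  \sum_(m : {ffun 'I_n -> 'I_n.+1} |
          (\sum_(i < n) m i == k)%N && (\sum_(i < n) i.+1 * m i == n)%N)
    (n`!%:R / (\prod_(i < n) (m i)`!)%:R)
      *: \prod_(i < n) (if i == 0%N :> nat then var 0 ^+ (k - m i)
                        else ((i.+1)`!%:R^-1 *: var i.+1) ^+ m i).

Lemma only_vars_bell_reduced n k :
  only_vars (fun i => (i == 0)%N || (1 < i <= n - k + 1))%N (bell_reduced n k).
Proof.
apply: only_vars_sum => m /andP[sk sn]; apply/only_varsZ/only_vars_prod => i _.
case: ifPn => i0; first exact/only_varsX/only_vars_var.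
have [->|mi] := eqVneq (m i : nat) 0%N; first by rewrite expr0; apply: only_vars1.
apply/only_varsX/only_varsZ/only_vars_var.
by rewrite /= (bell_bound sk sn mi) andbT ltnS lt0n.
Qed.

Lemma bell_reducedP n k :
  (0 < n)%N -> laurent_eq (var 0 ^+ k * bell n k) (bell_reduced n k).
Proof.
case: n => // n _; rewrite /bell mulr_sumr; apply: laurent_eq_sum => m.
move=> /andP[/eqP sk _]; rewrite -scalerAr; apply: laurent_eqZ.
rewrite !(bigD1 ord0 (P := predT)) //= mulrA -[1`!]/1%N invr1 scale1r.
apply: laurent_eqM; last first.
  by apply: laurent_eqW; apply: eq_bigr => i i0; rewrite ifN.
have le : (m ord0 <= k)%N by rewrite -sk (bigD1 ord0) //= leq_addr.
rewrite -{1}(subnK le) exprD -mulrA -[X in laurent_eq _ X]mulr1.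
by apply: laurent_eqM (laurent_eqXX _); apply: laurent_eqxx.
Qed.

Lemma bell_inverse_unique A A' : [pchar K] =i pred0 ->
    bell_inverse A -> bell_inverse A' ->
  forall n k, (0 < k <= n)%N -> A n k = A' n k.
Proof.
move=> K0 [fA eA] [fA' eA'] n k kn; have [d le] := ubnP (n - k).
elim: d => // d IHd in k kn le *; have /andP[k0 lekn] := kn.
apply/eqP; rewrite -subr_eq0; apply/eqP/laurent_eq0_free.
  apply: only_varsD; last apply: only_varsN.
    by apply: only_vars_sub (fA n k kn) => -[|[]].
  by apply: only_vars_sub (fA' n k kn) => -[|[]].
have := laurent_eqB (eA n k kn) (eA' n k kn).
rewrite [X in laurent_eq _ X]subrr -sumrB big_ltn ?ltnS // big1_seq => [|j /andP[_]]; last first.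
  rewrite mem_index_iota => /andP[kj jn].
  rewrite (IHd j) ?subrr //; first by rewrite (leq_trans k0 (ltnW kj)).
  by rewrite -ltnS (leq_trans _ le) // ltnS ltn_sub2l // (leq_trans kj).
rewrite addr0 -mulrBl bell_diag //; move: (A n k - A' n k) => p ep.
have := laurent_eqM (laurent_eqxx (var 0 ^+ k)) ep; rewrite mulr0.
apply: laurent_eq_trans; rewrite mulrCA -[X in laurent_eq X _]mulr1.
apply: laurent_eqM (laurent_eqxx _) _.
by have [r er] := laurent_eqXX k; exists (- r); rewrite mulNr -er opprB.
Qed.

Lemma bell_inverse_exists :
  {A : nat -> nat -> lpoly K | [pchar K] =i pred0 -> bell_inverse A}.
Proof.
have [a [ann aS]] := triangular_recursion (fun n => var 0 ^+ n) bell_reduced.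
exists a => K0.
split=> n k /andP[k0 kn].
  have [d le] := ubnP (n - k); elim: d => // d IHd in k k0 kn le *.
  have [->|nk] := eqVneq k n.
    by rewrite ann; apply/only_varsX/only_vars_var.
  rewrite aS; last by rewrite ltn_neqAle nk.
  apply/only_varsN; rewrite big_nat; apply: only_vars_sum => j jn.
  apply: only_varsM.
    by apply: (only_vars_sub _ (IHd j _ _ _)) => [i|||]; lia.
  by apply: (only_vars_sub _ (@only_vars_bell_reduced j k)) => i; lia.
rewrite big_ltn ?ltnS // bell_diag //.
have [->|nk] := eqVneq k n.
  by rewrite ann big_geq // addr0; apply: laurent_eqXX.
rewrite aS; last by rewrite ltn_neqAle nk.
apply: laurent_eq_trans (laurent_eqW (addNr _)).
apply: laurent_eqD (laurent_eqxx _); rewrite mulNr; apply: laurent_eqN.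
rewrite mulr_suml [X in laurent_eq X]big_nat [X in laurent_eq _ X]big_nat.
apply: laurent_eq_sum => j jn; rewrite -mulrA.
apply: laurent_eqM (laurent_eqxx _) _.
have j0 : (0 < j)%N by lia.
have [r er] := bell_reducedP k j0.
apply: (@laurent_eq_trans (var 0 ^+ k * bell j k * var 1 ^+ k)).
  by apply: laurent_eqM (laurent_eqxx _); exists (- r); rewrite mulNr -er opprB.
rewrite mulrAC -[X in laurent_eq _ X]mul1r.
by apply: laurent_eqM (laurent_eqxx _); apply: laurent_eqXX.
Qed.

(* The family (A_{n,k}) is opaque: it is only known through bell_inverse. *)
Definition bellA : nat -> nat -> lpoly K := sval bell_inverse_exists.

Lemma bellAP : [pchar K] =i pred0 -> bell_inverse bellA.
Proof. exact: svalP bell_inverse_exists. Qed.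

(* A representative in lpoly K of the Laurent polynomial L_{n,k}; by
   laurent_eval_eq, its values do not depend on this choice. *)
Definition lah (n k : nat) : lpoly K :=
  \sum_(k <= j < n.+1) (-1) ^+ j * bellA n j * bell j k.

(* Substitution in L_{n,1} only depends on the values of X_1, ..., X_{2[n/2]}. *)
Lemma eq_lah_eval (g h : nat -> K) n : [pchar K] =i pred0 ->
    g 1%N != 0 -> h 1%N != 0 -> (0 < n)%N ->
    (forall i, (0 < i <= 2 * n./2)%N -> g i = h i) ->
  laurent_eval g (lah n 1) = laurent_eval h (lah n 1).
Proof.
move=> /bellAP[supA eqA] g1 h1 n0 gh.
pose a (x : nat -> K) j := laurent_eval x (bellA n j) * laurent_eval x (bell j 1).
have aE x : laurent_eval x (lah n 1) = \sum_(1 <= j < n.+1) (-1) ^+ j * a x j.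
  rewrite laurent_eval_sum; apply: eq_bigr => j _.
  by rewrite !laurent_evalM laurent_eval_sign mulrA.
have n1 : (0 < 1 <= n)%N by rewrite n0.
have aS x : x 1%N != 0 -> \sum_(1 <= j < n.+1) a x j = (n == 1%N)%:R.
  move=> x1; have := laurent_eval_eq x1 (eqA n 1 n1).
  rewrite laurent_eval_nat laurent_eval_sum => <-.
  by apply: eq_bigr => j _; rewrite laurent_evalM.
have aL x : x 1%N != 0 -> laurent_eval x (lah n 1)
    = \sum_(2 <= j < n.+1) (1 + (-1) ^+ j) * a x j - (n == 1%N)%:R.
  move=> x1; rewrite aE -(aS x x1) !(big_ltn (m := 1)) ?ltnS //.
  rewrite [X in _ = X - _](eq_bigr (fun j => a x j + (-1) ^+ j * a x j)).
    by rewrite big_split /=; ring.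
  by move=> j _; rewrite mulrDl mul1r.
rewrite !aL //; congr (_ - _); rewrite !big_nat; apply: eq_bigr => j jn.
have [oj|ej] := boolP (odd j); first by rewrite -signr_odd oj addrN !mul0r.
have n2 : (1 < n)%N by lia.
have gh1 : g 1%N = h 1%N by apply: gh; lia.
have ghP i : (i == 0)%N || (0 < i <= 2 * n./2)%N ->
    laurent_point g i = laurent_point h i.
  by rewrite /laurent_point; case: eqVneq => [_ _|_ /= /gh //]; rewrite gh1.
congr (_ * (_ * _)).
  apply: eq_laurent_eval (supA n j _) _ => [|i /= ij]; first by lia.
  by apply: ghP; lia.
apply: eq_laurent_eval (@only_vars_bell j 1) _ => i ij; apply: ghP.
by lia.
Qed.

End LaurentPolynomials.

(* Main.v *)
(* Let G = \sum_(n > 0) g_n x^n / n! and let h be its compositional inverse.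
   Since B_{n,k}(g) = n!/k! [x^n] G^k and A_{n,k}(g) = n!/k! [x^n] h^k, the
   values L_{n,1}(g) are the Taylor coefficients of G o (-h).  So the statement
   says that the involutory f <> id are the conjugates of -id.  Such a conjugate
   is an involution; conversely, if f o f = id, then (id + f) o f = id + f and
   (id - f) o f = -(id - f).  As f'(0) = 1 or -1, one of id + f and id - f is
   invertible: the former would give f = id, the latter conjugates f to -id. *)
Require Import Defs.
From mathcomp Require Import all_boot all_algebra ring zify.
From mathcomp.multinomials Require Import monalg.

Set Implicit Arguments.
Unset Strict Implicit.
Unset Printing Implicit Defensive.

Import GRing.Theory.
Local Open Scope ring_scope.

(** * Composition of power series and compositional inverses *)

Section PowerSeriesComposition.
Variable K : fieldType.
Implicit Types f g h : fps K.

Definition fps_opp f : fps K := fun n => - f n.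

(** Coefficients of degree below [N] in products and powers depend only on these truncations, so
    ring identities are inherited from [{poly K}]. *)
Definition fps_trunc N f : {poly K} := \poly_(i < N) f i.

Lemma coef_fps_trunc N f i : (i < N)%N -> (fps_trunc N f)`_i = f i.
Proof. by move=> iN; rewrite coef_poly iN. Qed.

Lemma eq_fps_mul f f' g g' :
  f =1 f' -> g =1 g' -> fps_mul f g =1 fps_mul f' g'.
Proof. by move=> ff' gg' n; apply: eq_bigr => i _; rewrite ff' gg'. Qed.

Lemma fps_powS f k : fps_pow f k.+1 = fps_mul f (fps_pow f k).
Proof. by []. Qed.

Lemma eq_fps_pow f g k : f =1 g -> fps_pow f k =1 fps_pow g k.
Proof. by move=> fg; elim: k => //= k IHk; apply: eq_fps_mul. Qed.

Lemma eq_fps_comp f f' g g' :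
  f =1 f' -> g =1 g' -> fps_comp f g =1 fps_comp f' g'.
Proof.
by move=> ff' gg' n; apply: eq_bigr => i _; rewrite ff' (eq_fps_pow i gg').
Qed.

Lemma fps_mul_trunc N f g n :
  (n < N)%N -> fps_mul f g n = (fps_trunc N f * fps_trunc N g)`_n.
Proof.
move=> nN; rewrite coefM; apply: eq_bigr => i _.
by rewrite !coef_fps_trunc //; have := ltn_ord i; lia.
Qed.

Lemma fps_pow_trunc N f k n :
  (n < N)%N -> fps_pow f k n = (fps_trunc N f ^+ k)`_n.
Proof.
elim: k n => [|k IHk] n nN; first by rewrite expr0 coef1.
rewrite fps_powS exprS coefM; apply: eq_bigr => i _.
by rewrite coef_fps_trunc ?IHk //; have := ltn_ord i; lia.
Qed.

Lemma fps_trunc_mulX N f : f 0%N = 0 ->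
  fps_trunc N.+1 f = 'X * fps_trunc N (fun i => f i.+1).
Proof.
move=> f0; apply/polyP => -[|i]; rewrite coefXM coef_poly //=.
by rewrite coef_poly ltnS.
Qed.

Lemma fps_pow_small f k n : f 0%N = 0 -> (n < k)%N -> fps_pow f k n = 0.
Proof.
move=> f0 nk; rewrite (@fps_pow_trunc n.+1) // fps_trunc_mulX //.
by rewrite exprMn coefXnM nk.
Qed.

Lemma fps_pow_diag f n : f 0%N = 0 -> fps_pow f n n = f 1%N ^+ n.
Proof.
move=> f0; rewrite (@fps_pow_trunc n.+2) // fps_trunc_mulX //.
rewrite exprMn coefXnM ltnn subnn -horner_coef0 horner_exp horner_coef0.
by rewrite coef_fps_trunc.
Qed.

Lemma fps_pow_opp f k n : fps_pow (fps_opp f) k n = (-1) ^+ k * fps_pow f k n.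
Proof.
rewrite !(@fps_pow_trunc n.+1) //.
have -> : fps_trunc n.+1 (fps_opp f) = - fps_trunc n.+1 f.
  by apply/polyP => i; rewrite coefN !coef_poly; case: ifP; rewrite ?oppr0.
by rewrite [(- fps_trunc _ _) ^+ _]exprNn -(rmorph_sign polyC) coefCM.
Qed.

Lemma fps_pow_id k n : fps_pow (fps_id K) k n = (n == k)%:R.
Proof.
rewrite (@fps_pow_trunc n.+2) // (_ : fps_trunc _ _ = 'X) ?coefXn //.
apply/polyP => i; rewrite coefX coef_poly /fps_id.
by case: eqVneq => [->|_] //; case: ifP.
Qed.

(** A bound independent of [n] is what allows double sums to be exchanged; the added terms vanish
    because x^k divides g^k. *)
Lemma fps_comp_widen M f g n : g 0%N = 0 -> (n < M)%N ->
  fps_comp f g n = \sum_(k < M) f k * fps_pow g k n.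
Proof.
move=> g0 nM.
rewrite [LHS](big_ord_widen M (fun k => f k * fps_pow g k n)) //.
rewrite [LHS]big_mkcond; apply: eq_bigr => k _; case: ltnP => // nk.
by rewrite fps_pow_small ?mulr0.
Qed.

Lemma coef_comp_trunc N (p : {poly K}) g n : g 0%N = 0 -> (n < N)%N ->
  (p \Po fps_trunc N g)`_n = fps_comp (fun i => p`_i) g n.
Proof.
move=> g0 nN; rewrite coef_comp_poly.
rewrite (@fps_comp_widen (maxn N (size p))) ?leq_max ?nN //.
rewrite [LHS](big_ord_widen (maxn N (size p))
  (fun k => p`_k * (fps_trunc N g ^+ k)`_n)) ?leq_maxr //.
rewrite [LHS]big_mkcond; apply: eq_bigr => k _; rewrite (@fps_pow_trunc N) //.
by case: ltnP => // ?; rewrite nth_default ?mul0r.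
Qed.

(** Transferred from [comp_polyM] by truncating all three series. *)
Lemma fps_compM f g h : h 0%N = 0 ->
  fps_comp (fps_mul f g) h =1 fps_mul (fps_comp f h) (fps_comp g h).
Proof.
move=> h0 n; transitivity
  (((fps_trunc n.+1 f * fps_trunc n.+1 g) \Po fps_trunc n.+1 h)`_n).
  rewrite coef_comp_trunc //; apply: eq_bigr => k _.
  by rewrite (@fps_mul_trunc n.+1).
rewrite comp_polyM coefM; apply: eq_bigr => i _.
rewrite !coef_comp_trunc //; last by have := ltn_ord i; lia.
by congr (_ * _); apply: eq_bigr => k _; rewrite coef_fps_trunc //;
  have := ltn_ord i; have := ltn_ord k; lia.
Qed.

Lemma fps_comp_one h : fps_comp (fps_one K) h =1 fps_one K.
Proof.
move=> n; rewrite /fps_comp big_ord_recl mul1r big1 ?addr0 // => i _.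
by rewrite mul0r.
Qed.

Lemma fps_comp_pow g h k : h 0%N = 0 ->
  fps_comp (fps_pow g k) h =1 fps_pow (fps_comp g h) k.
Proof.
move=> h0; elim: k => [|k IHk] n; first exact: fps_comp_one.
by rewrite !fps_powS fps_compM //; apply: eq_fps_mul.
Qed.

(** Since (g o h)^j = g^j o h, both sides expand to the same double sum. *)
Lemma fps_compA f g h : g 0%N = 0 -> h 0%N = 0 ->
  fps_comp f (fps_comp g h) =1 fps_comp (fps_comp f g) h.
Proof.
move=> g0 h0 n; transitivity
  (\sum_(k < n.+1) \sum_(j < n.+1) f j * fps_pow g j k * fps_pow h k n).
  rewrite exchange_big; apply: eq_bigr => j _ /=; rewrite -fps_comp_pow //.
  by rewrite mulr_sumr; apply: eq_bigr => k _; rewrite mulrA.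
by apply: eq_bigr => k _; rewrite (@fps_comp_widen n.+1) // mulr_suml.
Qed.

Lemma fps_comp0 f g : fps_comp f g 0%N = f 0%N.
Proof. by rewrite /fps_comp big_ord1 mulr1. Qed.

Lemma fps_comp1 f g : g 0%N = 0 -> fps_comp f g 1%N = f 1%N * g 1%N.
Proof.
move=> g0; rewrite /fps_comp big_ord_recl big_ord1 (fps_pow_diag 1) //=.
by rewrite mulr0 add0r.
Qed.

Lemma fps_id_comp g : g 0%N = 0 -> fps_comp (fps_id K) g =1 g.
Proof.
move=> g0 n; rewrite (@fps_comp_widen n.+2) // 2!big_ord_recl big1 => [|i _].
  rewrite mul0r add0r mul1r addr0 (@fps_pow_trunc n.+1) // expr1.
  by rewrite coef_fps_trunc.
by rewrite mul0r.
Qed.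

Lemma fps_comp_id f : fps_comp f (fps_id K) =1 f.
Proof.
move=> n; rewrite /fps_comp (bigD1 ord_max) //= fps_pow_id eqxx mulr1.
rewrite big1 ?addr0 // => i ni; rewrite fps_pow_id.
by rewrite [_ == _](_ : _ = false) ?mulr0 // eq_sym; apply/negbTE.
Qed.

Lemma fps_comp_opp f g : fps_comp (fps_opp f) g =1 fps_opp (fps_comp f g).
Proof.
by move=> n; rewrite /fps_opp -sumrN; apply: eq_bigr => k _; rewrite mulNr.
Qed.

Lemma fps_comp_add f g h :
  fps_comp (fun n => f n + g n) h =1 (fun n => fps_comp f h n + fps_comp g h n).
Proof.
by move=> n; rewrite -big_split; apply: eq_bigr => k _; rewrite mulrDl.
Qed.

(** The coefficient of x^n in h o g is h_n g_1^n plus terms in h_k with k < n, so h_n can be solved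
    for recursively. *)
Lemma fps_left_inverse g : g 0%N = 0 -> g 1%N != 0 ->
  {h | h 0%N = 0 /\ h 1%N != 0 & fps_comp h g =1 fps_id K}.
Proof.
move=> g0 g1.
pose step h n :=
  (fps_id K n - \sum_(k < n) h k * fps_pow g k n) / g 1%N ^+ n.
have [|h hE] := @strong_recursion K 0 step.
  by move=> s s' n ss'; congr ((_ - _) / _); apply: eq_bigr => k _; rewrite ss'.
have hg : fps_comp h g =1 fps_id K.
  move=> n; rewrite /fps_comp big_ord_recr /= fps_pow_diag // (hE n) /step.
  by rewrite divfK ?expf_neq0 // addrC subrK.
have h0 : h 0%N = 0 by rewrite -(fps_comp0 h g) hg.
exists h => //; split=> //; apply/eqP => h1.
by have /eqP := hg 1%N; rewrite fps_comp1 // h1 mul0r eq_sym oner_eq0.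
Qed.

(** If k is a left inverse of h, then g = (k o h) o g = k o (h o g) = k. *)
Lemma fps_right_inverse g h : h 0%N = 0 -> h 1%N != 0 -> g 0%N = 0 ->
  fps_comp h g =1 fps_id K -> fps_comp g h =1 fps_id K.
Proof.
move=> h0 h1 g0 hg; have [k [k0 _] kh] := fps_left_inverse h0 h1.
have gk : g =1 k.
  move=> n; rewrite -(fps_id_comp g0) -(eq_fps_comp kh (frefl g)).
  by rewrite -fps_compA // (eq_fps_comp (frefl k) hg) fps_comp_id.
by move=> n; rewrite (eq_fps_comp gk (frefl h)) kh.
Qed.

End PowerSeriesComposition.

(** * Values of the Bell polynomials, of their inverse family and of L_{n,1} *)

Section BellPolynomials.
Variable K : fieldType.
Hypothesis K_char0 : [pchar K] =i pred0.

Lemma natf_fact_neq0 n : n`!%:R != 0 :> K.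
Proof. by move/pcharf0P: K_char0 => ->; rewrite -lt0n fact_gt0. Qed.

Section TruncatedExponential.
Variables (A : comAlgType K) (N : nat).

(** The series exp(c y) cut after y^N. It is applied with [A] = K[x], the variable y counting the
    number of factors. *)
Definition exp_trunc (c : A) : {poly A} :=
  \poly_(a < N.+1) ((a`!%:R^-1 : K) *: c ^+ a).

(** The binomial theorem divided by k!. *)
Lemma coef_exp_truncM (c d : A) k :
  \sum_(i < k.+1) ((i`!%:R^-1 : K) *: c ^+ i : A)
                   * (((k - i)`!%:R^-1 : K) *: d ^+ (k - i) : A)
  = (k`!%:R^-1 : K) *: (c + d) ^+ k.
Proof.
rewrite addrC exprDn scaler_sumr; apply: eq_bigr => i _.
rewrite -scalerAl -scalerAr scalerA mulrC -scaler_nat scalerA.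
congr (_ *: _); last exact: mulrC.
have ik : (i <= k)%N by rewrite -ltnS.
rewrite -(bin_fact ik) !natrM.
move: (natf_fact_neq0 i) (natf_fact_neq0 (k - i)).
have : 'C(k, i)%:R != 0 :> K.
  by move/pcharf0P: K_char0 => ->; rewrite -lt0n bin_gt0.
by move=> *; field; apply/and3P.
Qed.

(* exp is multiplicative, and exp_trunc c agrees with exp (c y) up to y^N. *)
Lemma coef_prod_exp_trunc (I : Type) (r : seq I) (c : I -> A) k : (k <= N)%N ->
  (\prod_(i <- r) exp_trunc (c i))`_k
  = (k`!%:R^-1 : K) *: (\sum_(i <- r) c i) ^+ k.
Proof.
elim: r k => [|i r IHr] k kN.
  rewrite !big_nil coef1 expr0n; case: k {kN} => [|k]; last by rewrite scaler0.
  by rewrite invr1 scale1r.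
rewrite !big_cons -coef_exp_truncM // coefM; apply: eq_bigr => j _.
by rewrite coef_poly IHr ?ltnS (leq_trans _ kN) ?leq_subr // -ltnS.
Qed.

End TruncatedExponential.

(** The constant term is forced to 0 because [g 0] carries no meaning: index 0 is reserved for
    X_1^-1. *)
Definition egf (g : nat -> K) : fps K :=
  fun n => if n is 0 then 0 else g n / n`!%:R.

Lemma laurent_evalZ g (c : K) (p : lpoly K) :
  laurent_eval g (c *: p) = c * laurent_eval g p.
Proof. exact: monalg.mmapZ. Qed.

Lemma laurent_eval_bellE g n k : laurent_eval g (bell K n k) =
  \sum_(m : {ffun 'I_n -> 'I_n.+1} |
          (\sum_(i < n) m i == k)%N && (\sum_(i < n) i.+1 * m i == n)%N)
    (n`!%:R / (\prod_(i < n) (m i)`!)%:R)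
      * \prod_(i < n) egf g i.+1 ^+ m i.
Proof.
rewrite laurent_eval_sum; apply: eq_bigr => m _; rewrite laurent_evalZ.
congr (_ * _); rewrite [LHS]rmorph_prod; apply: eq_bigr => i _.
rewrite [LHS]rmorphXn; congr (_ ^+ _).
by rewrite [LHS]laurent_evalZ laurent_eval_var mulrC.
Qed.

Lemma laurent_eval_bell g n k : (0 < k <= n)%N ->
  laurent_eval g (bell K n k) = n`!%:R / k`!%:R * fps_pow (egf g) k n.
Proof.
move=> /andP[k0 kn].
(* Read off the coefficient of y^k x^n in the product of the truncated
   exponentials of y (g_i x^i / i!), for 1 <= i <= n. *)
pose c (i : 'I_n) : {poly K} := egf g i.+1 *: 'X^(i.+1).
have sumc : \sum_i c i = fps_trunc n.+1 (egf g).
  by rewrite /fps_trunc poly_def big_ord_recl scale0r add0r.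
have := coef_prod_exp_trunc (index_enum 'I_n) c kn.
rewrite sumc => /(congr1 (fun p : {poly K} => n`!%:R * p`_n)).
rewrite coefZ -fps_pow_trunc // mulrA => <-; rewrite laurent_eval_bellE.
have termE (m : {ffun 'I_n -> 'I_n.+1}) :
    \prod_i (((m i)`!%:R^-1 : K) *: c i ^+ m i *: 'X^(m i))
    = ((\prod_(i < n) (m i)`!)%:R^-1 * \prod_(i < n) egf g i.+1 ^+ m i)
        *: 'X^(\sum_(i < n) i.+1 * m i) *: 'X^(\sum_(i < n) m i)
    :> {poly {poly K}}.
  rewrite scaler_prod prodrXr; congr (_ *: _).
  under eq_bigr do rewrite exprZn -exprM scalerA.
  by rewrite scaler_prod prodrXr big_split prodfV natr_prod.
rewrite [in RHS](eq_bigr (fun i =>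
  \sum_(a < n.+1) ((a`!%:R^-1 : K) *: c i ^+ a) *: 'X^a)); last first.
  by move=> i _; rewrite /exp_trunc poly_def.
(* Expanding the product chooses an exponent [m i] in each factor; the coefficients of y^k and x^n
   then impose the two conditions of the Bell sum. *)
rewrite bigA_distr_bigA /= coef_sum coef_sum mulr_sumr big_mkcond /=.
apply: eq_bigr => m _; rewrite termE coefZ coefXn eq_sym.
case: eqVneq => _ /=; last by rewrite mulr0 coef0 mulr0.
rewrite mulr1 coefZ coefXn eq_sym.
by case: eqVneq => _ /=; rewrite ?mulr1 ?mulr0 ?mulrA.
Qed.

Lemma laurent_eval_bellA (g : nat -> K) (h : fps K) n k :
    g 1%N != 0 -> h 0%N = 0 -> fps_comp h (egf g) =1 fps_id K ->
    (0 < k <= n)%N ->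
  laurent_eval g (bellA K n k) = n`!%:R / k`!%:R * fps_pow h k n.
Proof.
move=> g1 h0 hg kn.
have [_ eqA] := bellAP K_char0.
(* Up to factorials, (A_{n,j}) is a left inverse and ([x^j] h^i) a right inverse
   of the matrix ([x^j] G^i), for G = egf g; hence they agree. *)
pose b j := laurent_eval g (bellA K n j) * j`!%:R.
have G0 : egf g 0%N = 0 by [].
have bG i : (0 < i <= n)%N ->
    \sum_(1 <= j < n.+1) b j * fps_pow (egf g) i j = n`!%:R * (n == i)%:R.
  move=> /[dup] /eqA/(laurent_eval_eq g1) + /andP[i0 ni].
  rewrite laurent_eval_sum laurent_eval_nat => eq_i.
  (* The defining relation starts at [j = i]; the terms with [j < i] vanish, as x^i divides G^i. *)
  rewrite (@big_cat_nat _ _ _ i) //=; last exact: leqW.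
  rewrite big_nat big1 ?add0r => [|j /andP[_ ji]]; last first.
    by rewrite fps_pow_small ?mulr0.
  transitivity (i`!%:R * (n == i)%:R : K); last first.
    by case: eqVneq => [->|]; rewrite ?mulr0.
  rewrite -eq_i mulr_sumr; apply: eq_big_nat => j /andP[ij jn].
  rewrite laurent_evalM laurent_eval_bell ?i0 //.
  by rewrite /b; field; apply: natf_fact_neq0.
suff: b k = n`!%:R * fps_pow h k n.
  by rewrite mulrAC => <-; rewrite /b mulfK ?natf_fact_neq0.
have /andP[k0 _] := kn.
transitivity (\sum_(1 <= j < n.+1) b j * (j == k)%:R).
  rewrite (bigD1_seq k) ?iota_uniq ?mem_index_iota //= eqxx mulr1.
  by rewrite big1 ?addr0 // => j /negbTE ->; rewrite mulr0.
(* The Kronecker delta is [x^j] (h o G)^k, expanded in powers of G; its term [i = 0] drops out since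
   [k > 0]. After the exchange, [bG] collapses the sum over [j]. *)
transitivity (\sum_(1 <= j < n.+1) \sum_(1 <= i < n.+1)
    fps_pow h k i * (b j * fps_pow (egf g) i j)).
  apply: eq_big_nat => j /andP[_ jn].
  rewrite -fps_pow_id -(eq_fps_pow k hg) -fps_comp_pow //.
  rewrite (fps_comp_widen _ _ jn) //.
  rewrite -(big_mkord predT (fun i => fps_pow h k i * fps_pow (egf g) i j)).
  rewrite big_ltn // fps_pow_small // mul0r add0r mulr_sumr.
  by apply: eq_bigr => i _; rewrite mulrCA.
rewrite exchange_big /=.
transitivity (\sum_(1 <= i < n.+1) fps_pow h k i * (n`!%:R * (n == i)%:R)).
  by apply: eq_big_nat => i iP; rewrite -mulr_sumr bG.
rewrite (bigD1_seq n) ?iota_uniq ?mem_index_iota //=; last by lia.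
rewrite eqxx mulr1 mulrC big1 ?addr0 // => i; rewrite eq_sym => /negbTE ->.
by rewrite !mulr0.
Qed.

(** As B_{j,1}(g) = g_j, the j-th summand is n! [x^j]G [x^n](-h)^j, the sign being absorbed into the
    power of -h. *)
Lemma laurent_eval_lah (g : nat -> K) (h : fps K) n :
    g 1%N != 0 -> h 0%N = 0 -> fps_comp h (egf g) =1 fps_id K -> (0 < n)%N ->
  laurent_eval g (lah K n 1) = taylor (fps_comp (egf g) (fps_opp h)) n.
Proof.
move=> g1 h0 hg n0; rewrite /taylor /fps_comp.
rewrite -(big_mkord predT (fun k => egf g k * fps_pow (fps_opp h) k n)).
rewrite big_ltn // mul0r add0r mulr_sumr laurent_eval_sum.
apply: eq_big_nat => j /andP[j0 jn].
rewrite !laurent_evalM laurent_eval_sign fps_pow_opp.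
rewrite (laurent_eval_bellA g1 h0 hg) ?j0 // laurent_eval_bell //.
rewrite (@fps_pow_trunc _ j.+1 _ 1) // expr1 coef_fps_trunc // invr1 mulr1.
by field; apply: natf_fact_neq0.
Qed.

End BellPolynomials.

(** * Involutions as conjugates of -id *)

Lemma egf_taylor (K : fieldType) (g : fps K) : [pchar K] =i pred0 ->
  g 0%N = 0 -> egf (taylor g) =1 g.
Proof.
by move=> K0 g0 [//|n]; rewrite /= /taylor mulrC mulKf // natf_fact_neq0.
Qed.

Theorem theorem4p2 (K : fieldType) (K_char0 : [pchar K] =i pred0)
    (f : fps K) (f_inv : fps_invertible f) (f_neq_id : ~ (f =1 fps_id K)) :
  involutory f <->
  exists2 g : nat -> K, g 1%N != 0 &
    forall n : nat, (0 < n)%N -> taylor f n = laurent_eval g (lah K n 1).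
Proof.
have [f0 f1] := f_inv.
have taylor1 (h : fps K) : taylor h 1 = h 1%N by rewrite /taylor mul1r.
split=> [ff | [g g1 fE]]; last first.
  have G1 : egf g 1%N != 0 by rewrite /= divr1.
  have [h [h0 h1] hG] := fps_left_inverse (erefl : egf g 0%N = 0) G1.
  have Gh := fps_right_inverse h0 h1 (erefl : egf g 0%N = 0) hG.
  have oh0 : fps_opp h 0%N = 0 by rewrite /fps_opp h0 oppr0.
  have fG : f =1 fps_comp (egf g) (fps_opp h).
    case=> [|n]; first by rewrite fps_comp0 f0.
    apply: (mulfI (natf_fact_neq0 K_char0 n.+1)).
    by rewrite -[LHS]/(taylor f n.+1) fE // (laurent_eval_lah _ g1 h0 hG).
  (* From f = G o (-h) follows h o f = -h, whence f o f = G o ((-h) o f) = G o h = id. *)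
  have hf : fps_comp (fps_opp h) f =1 h.
    move=> n; rewrite fps_comp_opp /fps_opp (eq_fps_comp (frefl h) fG).
    rewrite fps_compA // (eq_fps_comp hG (frefl _)) fps_id_comp //.
    by rewrite /fps_opp opprK.
  move=> n; rewrite (eq_fps_comp fG (frefl f)) -fps_compA //.
  by rewrite (eq_fps_comp (frefl _) hf) Gh.
have f1s : (f 1%N == 1) || (f 1%N == -1).
  by rewrite -sqrf_eq1 expr2 -fps_comp1 // ff.
(* In both cases the series [h] below has linear coefficient 1 + 1. *)
have two : 2%:R != 0 :> K by move/pcharf0P: K_char0 => ->.
case/orP: f1s => /eqP f1E.
  case: f_neq_id; pose h : fps K := fun n => fps_id K n + f n.
  have h0 : h 0%N = 0 by rewrite /h f0 addr0.
  have h1 : h 1%N != 0 by rewrite /h f1E.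
  have hf : fps_comp h f =1 h.
    by move=> n; rewrite fps_comp_add fps_id_comp // ff addrC.
  have [k [k0 _] kh] := fps_left_inverse h0 h1.
  move=> n; rewrite -(fps_id_comp f0) -(eq_fps_comp kh (frefl f)) -fps_compA //.
  by rewrite (eq_fps_comp (frefl k) hf) kh.
pose h : fps K := fun n => fps_id K n + fps_opp f n.
have h0 : h 0%N = 0 by rewrite /h /fps_opp f0 oppr0 addr0.
have h1 : h 1%N != 0 by rewrite /h /fps_opp f1E opprK.
have hf : fps_comp h f =1 fps_opp h.
  move=> n; rewrite fps_comp_add fps_id_comp // fps_comp_opp /fps_opp ff.
  by rewrite /h /fps_opp opprB.
have [k [k0 k1] kh] := fps_left_inverse h0 h1.
have hk := fps_right_inverse k0 k1 h0 kh.
(* With this choice G is k, the inverse of h = id - f, and f = k o (h o f) = k o (-h). *)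
exists (taylor k); first by rewrite taylor1.
have kE := egf_taylor K_char0 k0.
move=> n n0; rewrite (@laurent_eval_lah _ K_char0 _ h) // ?taylor1 //; last first.
  by move=> m; rewrite (eq_fps_comp (frefl h) kE).
congr (_ * _); rewrite -(fps_id_comp f0) -(eq_fps_comp kh (frefl f)).
by rewrite -fps_compA // (eq_fps_comp (frefl k) hf) (eq_fps_comp kE (frefl _)).
Qed.
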